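(* For any two non-Archimedean metric spaces $(X,\widehat{d}_X)$ and $(Y,\widehat{d}_Y)$, $$\widehat{d}_{GH}(X,Y)=\inf_{\widehat{C}}\,(\operatorname{dis}\widehat{C}),$$ where the infimum is taken over all strong correspondences $\widehat{C}$ between $X$ and $Y$.
   Context: A non-Archimedean metric space $(X,\widehat{d}_X)$ is a set with a metric satisfying the strong triangle inequality $\widehat{d}_X(x,z)\le\max\{\widehat{d}_X(x,y),\widehat{d}_X(y,z)\}$. The non-Archimedean Gromov-Hausdorff distance is $\widehat{d}_{GH}(X,Y)=\inf\{\widehat{d}_{H}(f(X),g(Y))\}$, the infimum being over all non-Archimedean metric spaces $(Z,\widehat{d}_Z)$ and all isometric embeddings $f:X\hookrightarrow Z$, $g:Y\hookrightarrow Z$, where $\widehat{d}_H$ is the Hausdorff distance between subsets of $Z$ (it may be $\infty$). A correspondence between $X$ and $Y$ is a set $C\subset X\times Y$ such that for every $x\in X$ there is at least one $y\in Y$ with $(x,y)\in C$, and for every $y\in Y$ there is at least one $x\in X$ with $(x,y)\in C$. Its distortion is $\operatorname{dis}C=\sup\{|\widehat{d}_X(x,x')-\widehat{d}_Y(y,y')| : (x,y),(x',y')\in C\}$. A correspondence $C$ is called a strong correspondence if for any $(x,y)\in (X\times Y)\setminus C$ there exist $x'\in X$ and $y'\in Y$ such that $(x,y'),(x',y)\in C$ and $\widehat{d}_X(x,x')=\widehat{d}_Y(y,y')>\operatorname{dis}C$. *)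

(* Defs.v *)
From mathcomp Require Import all_boot all_order all_algebra.
From mathcomp Require Import all_classical all_reals all_analysis.

Set Implicit Arguments.
Unset Strict Implicit.
Unset Printing Implicit Defensive.

Import Order.TTheory GRing.Theory Num.Theory.

Local Open Scope classical_set_scope.
Local Open Scope ring_scope.

Definition non_archimedean (R : realType) (X : metricType R) : Prop :=
  forall x y z : X, mdist x z <= Num.max (mdist x y) (mdist y z).

Definition isometric_embedding (R : realType) (X Z : metricType R)
    (f : X -> Z) : Prop :=
  forall x x' : X, mdist (f x) (f x') = mdist x x'.

(* The infimum of the empty set is +oo: this is the value when no finite radius
   works, e.g. when exactly one of A and B is empty. *)
Definition hausdorff_dist (R : realType) (Z : metricType R) (A B : set Z) :
    \bar R :=
  ereal_inf [set r%:E | r in [set r : R |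
    [/\ 0 < r, A `<=` \bigcup_(b in B) ball b r &
               B `<=` \bigcup_(a in A) ball a r]]].

(* X, Y and Z live in the same universe, which is closed under sums, so the
   disjoint union of X and Y is an admissible carrier for Z. *)
Definition gromov_hausdorff_na (R : realType) (X Y : metricType R) : \bar R :=
  ereal_inf [set r : \bar R |
    exists (Z : metricType R) (f : X -> Z) (g : Y -> Z),
      [/\ non_archimedean Z, isometric_embedding f, isometric_embedding g &
          r = hausdorff_dist (range f) (range g)]].

Definition correspondence (T U : Type) (C : set (T * U)) : Prop :=
  (forall x : T, exists y : U, C (x, y)) /\
  (forall y : U, exists x : T, C (x, y)).

(* The supremum is taken in [0, +oo]. The maximum with 0 only matters when C is
   empty (for a correspondence: when both spaces are empty), where ereal_sup
   is -oo. *)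
Definition distortion (R : realType) (X Y : metricType R) (C : set (X * Y)) :
    \bar R :=
  maxe 0%E (ereal_sup [set r : \bar R | exists (x x' : X) (y y' : Y),
    [/\ C (x, y), C (x', y') & r = (`|mdist x x' - mdist y y'|)%:E]]).

Definition strong_correspondence (R : realType) (X Y : metricType R)
    (C : set (X * Y)) : Prop :=
  correspondence C /\
  forall (x : X) (y : Y), ~ C (x, y) ->
    exists (x' : X) (y' : Y),
      [/\ C (x, y'), C (x', y), mdist x x' = mdist y y' &
          (distortion C < (mdist x x')%:E)%E].

(* Main.v *)
(* Given isometric embeddings into an ultrametric Z whose images are at
   Hausdorff distance less than r, the pairs at distance at most r in Z form a
   strong correspondence of distortion at most r, because triangles in Z are
   isosceles with the two longest sides equal. Conversely, a strong
   correspondence C of distortion at most r preserves every distance larger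
   than r; this is what makes the strong triangle inequality hold on the
   disjoint union of X and Y when the distance from x to y is set to
   max(r, d(x, x')) for any x' with (x', y) in C. *)
From HB Require Import structures.
From mathcomp Require Import all_boot all_order all_algebra.
From mathcomp Require Import all_classical all_reals all_analysis.
From mathcomp Require Import lra.
Require Import Defs.

Set Implicit Arguments.
Unset Strict Implicit.
Unset Printing Implicit Defensive.

Import Order.TTheory GRing.Theory Num.Theory.

Local Open Scope classical_set_scope.
Local Open Scope ring_scope.

Lemma mdist_isosceles (R : realType) (X : metricType R) (x y z : X) :
  non_archimedean X -> mdist y z < mdist x y -> mdist x z = mdist x y.
Proof.
move=> hX yz; apply/le_anti; rewrite (le_trans (hX x y z)) /=; last first.
  by rewrite ge_max lexx ltW.
have := hX x z y; rewrite le_max (metric_sym z y) => /orP[//|].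
by rewrite leNgt yz.
Qed.

Lemma le_distortion (R : realType) (X Y : metricType R) (C : set (X * Y))
    (x x' : X) (y y' : Y) : C (x, y) -> C (x', y') ->
  ((`|mdist x x' - mdist y y'|)%:E <= distortion C)%E.
Proof.
move=> Cxy Cxy'; rewrite /distortion le_max; apply/orP; right.
by apply: ereal_sup_ubound; exists x, x', y, y'.
Qed.

Lemma mdistl_le_distortion (R : realType) (X Y : metricType R)
    (C : set (X * Y)) (x x' : X) (y : Y) : C (x, y) -> C (x', y) ->
  ((mdist x x')%:E <= distortion C)%E.
Proof.
move=> Cxy Cxy'; have := le_distortion Cxy Cxy'.
by rewrite mdistxx subr0 ger0_norm ?mdist_ge0.
Qed.

Lemma mdistr_le_distortion (R : realType) (X Y : metricType R)
    (C : set (X * Y)) (x : X) (y y' : Y) : C (x, y) -> C (x, y') ->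
  ((mdist y y')%:E <= distortion C)%E.
Proof.
move=> Cxy Cxy'; have := le_distortion Cxy Cxy'.
by rewrite mdistxx sub0r normrN ger0_norm ?mdist_ge0.
Qed.

Lemma strong_correspondence_thickening (R : realType) (X Y Z : metricType R)
    (f : X -> Z) (g : Y -> Z) (r : R) :
  non_archimedean Z -> isometric_embedding f -> isometric_embedding g ->
  0 < r ->
  range f `<=` \bigcup_(b in range g) ball b r ->
  range g `<=` \bigcup_(a in range f) ball a r ->
  let C := [set p : X * Y | mdist (f p.1) (g p.2) <= r] in
  strong_correspondence C /\ (distortion C <= r%:E)%E.
Proof.
move=> hZ hf hg r0 fg gf C.
have fgr x : exists y, mdist (f x) (g y) < r.
  have [_ [y _ <-]] := fg (f x) (imageT f x).
  by rewrite ballEmdist /= metric_sym; exists y.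
have gfr y : exists x, mdist (f x) (g y) < r.
  have [_ [x _ <-]] := gf (g y) (imageT g y).
  by rewrite ballEmdist /=; exists x.
have disC : (distortion C <= r%:E)%E.
  rewrite /distortion ge_max lee_fin (ltW r0) /=.
  apply: ge_ereal_sup => _ [x [x' [y [y' [/= Cxy Cxy' ->]]]]].
  rewrite /C /= in Cxy Cxy'; rewrite lee_fin -(hf x) -(hg y).
  (* Two chained inequalities through [g y] and [g y'] bound [mdist x x'] by
     [Num.max r (mdist y y')]; the other two give the symmetric bound. *)
  have := hZ (f x) (g y) (f x'); have := hZ (g y) (g y') (f x').
  have := hZ (g y) (f x) (g y'); have := hZ (f x) (f x') (g y').
  rewrite (metric_sym (g y') (f x')) (metric_sym (g y) (f x)).
  have := mdist_ge0 (f x) (f x'); have := mdist_ge0 (g y) (g y').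
  rewrite ler_norml !le_max; move=> ? ?.
  by move=> /orP[]? /orP[]? /orP[]? /orP[]?; apply/andP; split; lra.
split=> //; split.
  by split=> [x|y]; [have [y /ltW] := fgr x | have [x /ltW] := gfr y]; eexists; eauto.
move=> x y /= /negP; rewrite -ltNge => rxy.
(* Partners closer than [r] serve as witnesses: since [f x] and [g y] are more than [r] apart, both
   distances equal [mdist (f x) (g y)]. *)
have [y' xy'] := fgr x; have [x' x'y] := gfr y.
exists x', y'; rewrite /C /= !ltW//.
have xx' : mdist x x' = mdist (f x) (g y).
  rewrite -hf; apply: mdist_isosceles => //.
  by rewrite metric_sym (lt_trans x'y).
have yy' : mdist y y' = mdist (f x) (g y).
  rewrite -hg (metric_sym (f x)); apply: mdist_isosceles => //.
  by rewrite (metric_sym (g y)) (lt_trans xy').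
by split=> //; [rewrite xx' yy' | rewrite xx' (le_lt_trans disC) ?lte_fin].
Qed.

(** If [(x, y')] lies in [C], both distances are at most the distortion, so both maxima are [r].
    Otherwise strongness yields [x1] and [y1]; points with a common partner are within the
    distortion, so the isosceles property replaces [x'] by [x1] and [y] by [y1], and the distances
    agree. *)
Lemma strong_correspondence_max_mdist (R : realType) (X Y : metricType R)
    (C : set (X * Y)) (r : R) (x x' : X) (y y' : Y) :
  non_archimedean X -> non_archimedean Y -> strong_correspondence C ->
  (distortion C <= r%:E)%E -> C (x, y) -> C (x', y') ->
  Num.max r (mdist x x') = Num.max r (mdist y y').
Proof.
move=> hX hY [_ sC] disC Cxy Cxy'.
have [Cxy1|nCxy'] := pselect (C (x, y')).
  have dxx' := mdistl_le_distortion Cxy1 Cxy'.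
  have dyy' := mdistr_le_distortion Cxy Cxy1.
  by rewrite !max_l// -lee_fin; apply: le_trans disC.
have [x1 [y1 [Cxy1 Cx1y' eq1 dis1]]] := sC _ _ nCxy'.
have -> : mdist x x' = mdist x x1.
  apply: mdist_isosceles => //; rewrite -lte_fin.
  by apply: le_lt_trans dis1; exact: mdistl_le_distortion Cx1y' Cxy'.
have -> : mdist y y' = mdist y' y1.
  rewrite (metric_sym y); apply: mdist_isosceles => //.
  rewrite -lte_fin -eq1.
  by apply: le_lt_trans dis1; exact: mdistr_le_distortion Cxy1 Cxy.
by rewrite eq1.
Qed.

Lemma ultrametric_space (R : realType) (T : Type) (d : T -> T -> R) :
  (forall x, d x x = 0) -> (forall x y, 0 <= d x y) ->
  (forall x y, d x y = 0 -> x = y) -> (forall x y, d x y = d y x) ->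
  (forall y x z, d x z <= Num.max (d x y) (d y z)) ->
  exists (Z : metricType R) (i : T -> Z),
    non_archimedean Z /\ forall x y, mdist (i x) (i y) = d x y.
Proof.
move=> dxx d_ge0 d_pos d_sym d_ultra.
have d_triangle y x z : d x z <= d x y + d y z.
  by rewrite (le_trans (d_ultra y x z))// ge_max lerDl lerDr !d_ge0.
(* [{classic T}] equips the bare type [T] with the equality and choice structures that a
   [metricType] carries. *)
pose M := isMetric.Build R {classic T} dxx d_pos d_sym d_triangle.
pose Z : metricType R := HB.pack {classic T} M.
by exists Z, (fun t => t); split=> // x y z; exact: d_ultra.
Qed.

Lemma strong_correspondence_glue (R : realType) (X Y : metricType R)
    (C : set (X * Y)) (r : R) :
  non_archimedean X -> non_archimedean Y -> strong_correspondence C ->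
  0 < r -> (distortion C <= r%:E)%E ->
  exists (Z : metricType R) (f : X -> Z) (g : Y -> Z),
    [/\ non_archimedean Z, isometric_embedding f, isometric_embedding g &
        forall x y, C (x, y) -> mdist (f x) (g y) = r].
Proof.
move=> hX hY sC r0 disC; have [phi Cphi] := choice sC.1.2.
have phi_max y y' :
    Num.max r (mdist (phi y) (phi y')) = Num.max r (mdist y y').
  exact: strong_correspondence_max_mdist sC disC _ _.
have phi_le y y' : mdist (phi y) (phi y') <= Num.max r (mdist y y').
  by rewrite -phi_max le_max lexx orbT.
have le_phi y y' : mdist y y' <= Num.max r (mdist (phi y) (phi y')).
  by rewrite phi_max le_max lexx orbT.
(* The choice of partner [phi y] fixes the cross distance. All cross distances are at least [r > 0],
   which separates [X] from [Y]. *)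
pose d (p q : X + Y) : R := match p, q with
  | inl x, inl x' => mdist x x'
  | inl x, inr y | inr y, inl x => Num.max r (mdist x (phi y))
  | inr y, inr y' => mdist y y'
  end.
have [|||||Z [i [hZ di]]] := @ultrametric_space R (X + Y)%type d.
- by case=> ? /=; rewrite mdistxx.
- by case=> ? [] ? /=; rewrite ?le_max ?mdist_ge0 ?(ltW r0).
- case=> ? [] ? /=; try by move=> /mdist_positivity ->.
    by move=> /eqP; rewrite gt_eqF// lt_max r0.
  by move=> /eqP; rewrite gt_eqF// lt_max r0.
- by case=> ? [] ? //=; rewrite metric_sym.
(* The middle point comes first. Unless all three points lie in [Y], those in [Y] are moved to [X]
   by [phi]; [phi_le] and [le_phi] convert distances up to [r], which a cross distance absorbs. *)
- case=> [y|y] [x|x] [z|z] /=; rewrite ?ge_max ?le_max ?lexx ?orbT //=.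
  + by have := hX x y z; rewrite le_max.
  + by have := hX x y (phi z); rewrite le_max => /orP[]->; rewrite ?orbT.
  + by have := hX z y (phi x); rewrite le_max (metric_sym z y) => /orP[]->;
      rewrite ?orbT.
  + have := le_phi x z; rewrite le_max => /orP[->//|xz].
    have := le_trans xz (hX (phi x) y (phi z)).
    by rewrite le_max (metric_sym _ y) => /orP[]->; rewrite ?orbT.
  + by have := hX x (phi y) z; rewrite le_max (metric_sym (phi y) z) => /orP[]->;
      rewrite ?orbT.
  + have := hX x (phi y) (phi z); rewrite le_max => /orP[->|xz].
      by rewrite ?orbT.
    by have := le_trans xz (phi_le y z); rewrite le_max => /orP[]->;
      rewrite ?orbT.
  + have := hX z (phi y) (phi x); rewrite le_max => /orP[->|zx].
      by rewrite ?orbT.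
    have := le_trans zx (phi_le y x).
    by rewrite le_max (metric_sym y) => /orP[]->; rewrite ?orbT.
  + by have := hY x y z; rewrite le_max.
exists Z, (i \o inl), (i \o inr); split=> //.
- by move=> x x' /=; rewrite di.
- by move=> y y' /=; rewrite di.
move=> x y Cxy; rewrite /= di /= max_l// -lee_fin.
exact: le_trans (mdistl_le_distortion Cxy (Cphi y)) disC.
Qed.

Lemma hausdorff_dist_range_le (R : realType) (X Y Z : metricType R)
    (f : X -> Z) (g : Y -> Z) (r : R) : 0 <= r ->
  (forall x, exists y, mdist (f x) (g y) <= r) ->
  (forall y, exists x, mdist (f x) (g y) <= r) ->
  (hausdorff_dist (range f) (range g) <= r%:E)%E.
Proof.
move=> r0 fg gf; apply/lee_addgt0Pr => e e0; apply: ereal_inf_lbound.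
have re : r < r + e by rewrite ltrDl.
(* Balls are open and radii positive, so the closed bound [r], possibly 0, is enlarged by [e]. *)
exists (r + e) => //; split; first exact: le_lt_trans re.
- move=> _ [x _ <-]; have [y xy] := fg x; exists (g y); first exact: imageT.
  by rewrite ballEmdist /= metric_sym (le_lt_trans xy).
- move=> _ [y _ <-]; have [x xy] := gf y; exists (f x); first exact: imageT.
  by rewrite ballEmdist /= (le_lt_trans xy).
Qed.

Theorem theoremA (R : realType) (X Y : metricType R)
    (hX : non_archimedean X) (hY : non_archimedean Y) :
  gromov_hausdorff_na X Y =
  ereal_inf [set distortion C | C in
    [set C : set (X * Y) | strong_correspondence C]].
Proof.
apply/le_anti/andP; split.
- apply: le_ereal_inf_tmp => _ [C sC <-].
  (* The slack [e] gives a positive gluing radius even when the distortion is 0; infinite distortion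
     is trivial. *)
  apply/lee_addgt0Pr => e e0.
  have : (0 <= distortion C)%E by rewrite /distortion le_max lexx.
  case disC : (distortion C) => [s| |] // s0; last by rewrite leey.
  have r0 : 0 < s + e by rewrite ltr_wpDl.
  have [|Z [f [g [hZ hf hg Cfg]]]] := strong_correspondence_glue hX hY sC r0.
    by rewrite disC lee_fin lerDl ltW.
  apply: le_trans (_ : hausdorff_dist (range f) (range g) <= _)%E.
    by apply: ereal_inf_lbound; exists Z, f, g.
  rewrite -EFinD; apply: hausdorff_dist_range_le; first exact: ltW.
  + by move=> x; have [y /Cfg xy] := sC.1.1 x; exists y; rewrite xy.
  + by move=> y; have [x /Cfg xy] := sC.1.2 y; exists x; rewrite xy.
- apply: le_ereal_inf_tmp => _ [Z [f [g [hZ hf hg ->]]]].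
  (* The Hausdorff distance is itself an infimum, so it suffices to treat each admissible radius
     [r], without attaining the infimum. *)
  apply: le_ereal_inf_tmp => _ [r [r0 fg gf] <-].
  have [sC disC] := strong_correspondence_thickening hZ hf hg r0 fg gf.
  apply: le_trans disC; apply: ereal_inf_lbound; eexists; first exact: sC.
  by [].
Qed.
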